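(* In intensional Martin-Löf type theory (no truncation, no function extensionality assumed), for every type $X:\mathcal U$ we have a logical equivalence $$\mathrm{Pop}(X)\;\Leftrightarrow\;\prod_{P:\mathcal U}\mathrm{isProp}(P)\to(P\to X)\to(X\to P)\to P,$$ where $\mathrm{Pop}(X):\equiv\prod_{f:X\to X}\Big(\big(\prod_{x,y:X}f(x)=f(y)\big)\to\sum_{x:X}x=f(x)\Big)$.
   Context: Intensional Martin-Löf type theory with a universe $\mathcal U$, $\Sigma$, $\Pi$, $+$ and identity types (J only; no UIP/K). $\mathrm{isProp}(A):\equiv\prod_{a,b:A}a=b$. $A\Leftrightarrow B$ means there are functions $A\to B$ and $B\to A$. *)

(* Defs.v *)
From Corelib Require Export CRelationClasses.

(* One fixed predicative universe level: every type variable of sort [U] lives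
   at the same level, and [U] itself is not an element of [U]. *)
Definition U := Type.

(* The identity type with values in [U], instead of the [Prop]-valued [eq];
   its only eliminator is J, that is [Id_rect]. *)
Inductive Id (A : U) (a : A) : A -> U :=
| refl : Id A a a.

Arguments Id {A} a _.
Arguments refl {A} a.

Definition isProp (A : U) : U := forall a b : A, Id a b.

Definition Pop (X : U) : U :=
  forall f : X -> X,
    (forall x y : X, Id (f x) (f y)) -> {x : X & Id x (f x)}.

(* Main.v *)
(** A proposition [P] logically equivalent to [X] induces a weakly constant map
    [X -> P -> X], and a fixed point of it gives back an element of [P].
    Conversely, a weakly constant [f : X -> X] makes the type of fixed points
    of [f] logically equivalent to [X], so it is enough to know that this type
    is a proposition (Kraus's fixed point lemma).  The key is that [ap f r], for
    [r : x = y], depends only on [x] and [y]; hence for fixed points [(x, p)]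
    and [(y, q)] one can first prescribe the value [k] of [ap f r] and then take
    [r := p @ k @ q^-1], along which [p] is transported to [q]. *)
Require Import Defs.

Definition inverse {A : U} {a b : A} (p : Id a b) : Id b a :=
  match p with refl _ => refl a end.

Definition concat {A : U} {a b c : A} (p : Id a b) (q : Id b c) : Id a c :=
  match q with refl _ => p end.

Definition ap {A B : U} (f : A -> B) {a b : A} (p : Id a b) : Id (f a) (f b) :=
  match p with refl _ => refl (f a) end.

Lemma concat_Vp {A : U} {a b : A} (p : Id a b) :
  Id (concat (inverse p) p) (refl b).
Proof. destruct p; exact (refl _). Qed.

Lemma concat_pV_p {A : U} {a b c : A} (p : Id a c) (q : Id b c) :
  Id (concat (concat p (inverse q)) q) p.
Proof. destruct q; exact (refl _). Qed.

Definition weakly_constant {A B : U} (f : A -> B) : U :=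
  forall x y : A, Id (f x) (f y).

(** By J: the factor [inverse (c x x)] is there because [c x x] may be a nontrivial loop. *)
Lemma ap_weakly_constant {A B : U} (f : A -> B) (c : weakly_constant f)
    {x y : A} (r : Id x y) :
  Id (ap f r) (concat (inverse (c x x)) (c x y)).
Proof. destruct r; exact (inverse (concat_Vp (c x x))). Qed.

Definition fixed_point {X : U} (f : X -> X) : U := {x : X & Id x (f x)}.

(** The premise says, without inverses, that transport along [r] takes [p] to [q]. *)
Lemma fixed_point_path {X : U} (f : X -> X) {x y : X} (r : Id x y)
    (p : Id x (f x)) (q : Id y (f y)) :
  Id (concat p (ap f r)) (concat r q) ->
  Id (existT _ x p : fixed_point f) (existT _ y q).
Proof.
  destruct r; simpl; intro e.
  (* [concat] computes only on its second argument, so the left unit law needs J. *)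
  assert (refl_concat : forall (z : X) (s : Id x z), Id (concat (refl x) s) s)
    by (intros z s; destruct s; exact (refl _)).
  exact (ap (fun s => existT _ x s : fixed_point f)
            (concat e (refl_concat _ q))).
Qed.

Theorem isProp_fixed_point {X : U} (f : X -> X) (c : weakly_constant f) :
  isProp (fixed_point f).
Proof.
  intros [x p] [y q].
  set (k := concat (inverse (c x x)) (c x y)).
  apply (fixed_point_path f (concat (concat p k) (inverse q))).
  (* Both sides equal [concat p k]. *)
  exact (concat (ap (concat p) (ap_weakly_constant f c _))
                (inverse (concat_pV_p (concat p k) q))).
Qed.

Theorem theorem6p4 (X : U) :
  iffT (Pop X)
       (forall P : U, isProp P -> (P -> X) -> (X -> P) -> P).
Proof.
  split.
  - intros pop P propP g h.
    destruct (pop (fun x => g (h x)) (fun x y => ap g (propP (h x) (h y))))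
      as [x _].
    exact (h x).
  - intros H f c.
    (* Each value [f x] is a fixed point, since [c] identifies [f x] with [f (f x)]. *)
    exact (H (fixed_point f) (isProp_fixed_point f c) (@projT1 _ _)
             (fun x => existT _ (f x) (c x (f x)))).
Qed.
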